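(* Let $N$ be the size of the ID space. Let $\mathcal{A}$ be a deterministic leader election algorithm in the $\mathsf{Strong}\text{-}\mathsf{CD}$ model that is correct for every set of devices $V \subseteq [N]$ with $|V| = 2$. Let $k$ be its energy complexity and $t$ its time complexity. Then $t \geq \Omega(k N^{1/k})$.
   Context: Single-hop radio network: a set $V$ of devices, each device $v$ having a distinct identifier $\mathsf{ID}(v) \in [N] = \{1,\dots,N\}$; $N$ is known to all devices. Communication proceeds in synchronous time slots; in each slot each device (based on its ID, the known parameters and all feedback received so far) either stays idle, listens, or transmits a message. In the $\mathsf{Strong}\text{-}\mathsf{CD}$ model, transmitters and listeners receive silence if zero devices transmit, collision if at least two devices transmit, and the message if exactly one device transmits; idle devices receive nothing. Leader election: at termination exactly one device identifies itself as leader and all others as non-leaders. The time complexity is the worst-case number of time slots; the energy complexity is the worst-case maximum over all devices of the number of time slots in which the device listens or transmits. *)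

(* Defs.v *)
From mathcomp Require Import all_boot.

Set Implicit Arguments.
Unset Strict Implicit.
Unset Printing Implicit Defensive.

Inductive feedback (M : Type) : Type :=
| Nothing
| Silence
| Collision
| Message of M.

Inductive action (M : Type) : Type :=
| Idle
| Listen
| Transmit of M.

Inductive decision (M : Type) : Type :=
| Act of action M
| Halt of bool.

Arguments Nothing {M}.
Arguments Silence {M}.
Arguments Collision {M}.
Arguments Idle {M}.
Arguments Listen {M}.
Arguments Halt {M}.

(* ['I_N] stands for the ID space {1, .., N}. The history passed to the
   algorithm has one entry per elapsed slot, oldest first; entries [Nothing]
   for idle slots let a device count time. [Halt b] is final and consumes no
   slot; [b = true] means leader. *)
Definition algorithm (N : nat) (M : Type) : Type :=
  'I_N -> seq (feedback M) -> decision M.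

Section Execution.

Variables (N : nat) (M : Type) (A : algorithm N M) (V : {set 'I_N}).

Definition transmission (v : 'I_N) (h : seq (feedback M)) : option M :=
  if A v h is Act (Transmit m) then Some m else None.

(* The Strong-CD channel: what every transmitter and every listener receives
   when the devices of V have the local histories [hist]. *)
Definition channel (hist : 'I_N -> seq (feedback M)) : feedback M :=
  match pmap (fun v => transmission v (hist v)) (enum V) with
  | [::] => Silence
  | [:: m] => Message m
  | _ => Collision
  end.

(* The history of a halted device is frozen, hence so is its output. *)
Definition slot (hist : 'I_N -> seq (feedback M)) (v : 'I_N) :
    seq (feedback M) :=
  match A v (hist v) with
  | Halt _ => hist v
  | Act Idle => rcons (hist v) Nothing
  | Act _ => rcons (hist v) (channel hist)
  end.

Definition history (n : nat) : 'I_N -> seq (feedback M) :=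
  iter n slot (fun=> [::]).

Definition output (n : nat) (v : 'I_N) : option bool :=
  if A v (history n v) is Halt b then Some b else None.

Definition awake (n : nat) (v : 'I_N) : bool :=
  match A v (history n v) with
  | Act Listen | Act (Transmit _) => true
  | _ => false
  end.

Definition energy (n : nat) (v : 'I_N) : nat := \sum_(s < n) awake s v.

Definition terminated (n : nat) : bool := [forall v in V, isSome (output n v)].

Definition elects_leader : Prop :=
  exists n, exists2 l, l \in V &
    forall v, v \in V -> output n v = Some (v == l).

End Execution.

Definition least (P : nat -> Prop) (k : nat) : Prop :=
  P k /\ forall j, P j -> k <= j.

(* Worst cases over the inputs V satisfying D, as least upper bounds (so 0 when
   no V satisfies D). *)
Definition time_complexity (N : nat) (M : Type) (A : algorithm N M)
    (D : {set 'I_N} -> Prop) (t : nat) : Prop :=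
  least (fun b => forall V, D V -> terminated A V b) t.

Definition energy_complexity (N : nat) (M : Type) (A : algorithm N M)
    (D : {set 'I_N} -> Prop) (k : nat) : Prop :=
  least (fun b => forall V v n, D V -> v \in V -> energy A V n v <= b) k.

(* Main.v *)
(** Run each device as if its partner always copied its actions: listening
    yields silence and transmitting yields a collision. If the runs of two
    devices have the same listen/transmit pattern, they are what happens when
    exactly these two devices are present; their outputs must then differ. So
    a pattern, which is a word of length [t] over three letters with at most
    [k] non-idle letters, together with one output bit determines the ID.
    With [x = k / t <= 1], weighting a word by [x] to the number of its non-idle
    letters gives [#patterns * x ^ k <= (1 + 2 x) ^ t <= exp (2 k)], whence
    [N <= 2 (e ^ 2 t / k) ^ k]. *)

Require Import Defs.
From HB Require Import structures.
From mathcomp Require Import all_boot all_order all_algebra.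
From mathcomp Require Import all_classical all_reals all_analysis.

Set Implicit Arguments.
Unset Strict Implicit.
Unset Printing Implicit Defensive.

Import Order.TTheory GRing.Theory Num.Theory.
Local Open Scope ring_scope.

(** * Real executions: uniform channels, final outputs, energy *)

Section Execution.
Local Open Scope nat_scope.
Variables (N : nat) (M : Type) (A : algorithm N M) (V : {set 'I_N}).

Lemma channel_silence (hist : 'I_N -> seq (feedback M)) :
  (forall v, v \in V -> transmission A v (hist v) = None) ->
  channel A V hist = Silence.
Proof.
move=> noT; rewrite /channel.
have {}noT : forall v, v \in enum V -> transmission A v (hist v) = None.
  by move=> v; rewrite mem_enum; apply: noT.
suff -> : pmap (fun v => transmission A v (hist v)) (enum V) = [::] by [].
elim: (enum V) noT => //= v s IHs noT; rewrite noT ?mem_head //=.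
by apply: IHs => w ws; apply: noT; rewrite inE ws orbT.
Qed.

Lemma channel_collision (hist : 'I_N -> seq (feedback M)) :
  1 < #|V| -> (forall v, v \in V -> isSome (transmission A v (hist v))) ->
  channel A V hist = Collision.
Proof.
move=> V_gt1 allT; rewrite /channel.
have : size (pmap (fun v => transmission A v (hist v)) (enum V)) = #|V|.
  rewrite size_pmap cardE; apply/eqP; rewrite -all_count.
  by apply/allP => v; rewrite mem_enum => /allT.
by case: pmap => [|m [|m' s]] //= sz; rewrite -sz in V_gt1.
Qed.

Lemma output_stable (v : 'I_N) (n m : nat) (b : bool) :
  n <= m -> output A V n v = Some b -> output A V m v = Some b.
Proof.
move=> /subnK <-; elim: (m - n) => [|j IHj] // /IHj; rewrite addSn.
rewrite /output [history A V _.+1]/(slot A V (history A V (j + n))) /slot.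
by case E: (A v (history A V (j + n) v)) => [|b'] // [<-]; rewrite E.
Qed.

Lemma awake_terminated (v : 'I_N) (n m : nat) :
  terminated A V n -> v \in V -> n <= m -> awake A V m v = false.
Proof.
move=> /forallP/(_ v)/implyP term vV nm.
case E: (output A V n v) (term vV) => [b|] // _.
have := output_stable nm E; rewrite /output /awake.
by case: (A v _).
Qed.

(** Halted devices spend nothing, so only the first [n] slots contribute, at most one unit each. *)
Lemma energy_terminated (v : 'I_N) (n m : nat) :
  terminated A V n -> v \in V -> energy A V m v <= n.
Proof.
move=> term vV; rewrite /energy.
have [mn|nm] := leqP m n.
  apply: leq_trans mn; rewrite -[X in _ <= X]card_ord -sum1_card.
  by apply: leq_sum => s _; case: awake.
rewrite -(big_mkord xpredT (fun s => awake A V s v : nat)).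
rewrite (big_cat_nat (n := n)) ?(ltnW nm) //=.
rewrite [X in _ + X]big_nat [X in _ + X]big1 ?addn0.
  rewrite big_mkord -[X in _ <= X]card_ord -sum1_card.
  by apply: leq_sum => s _; case: awake.
by move=> s /andP[ns _]; rewrite (awake_terminated term vV ns).
Qed.

Lemma elects_leader_output_neq (u v : 'I_N) (n : nat) :
  V = [set u; v] -> u != v -> terminated A V n -> elects_leader A V ->
  output A V n u != output A V n v.
Proof.
move=> defV uv term [m [l lV out]].
have uV : u \in V by rewrite defV set21.
have vV : v \in V by rewrite defV set22.
(* The election may be witnessed at another slot [m]; since outputs are final, both are compared at
   [maxn n m]. *)
have final w : w \in V -> output A V n w = Some (w == l).
  move=> wV; move/forallP/(_ w)/implyP: term => /(_ wV).
  case E: (output A V n w) => [b|] // _.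
  have := output_stable (leq_maxl n m) E.
  by rewrite (output_stable (leq_maxr n m) (out w wV)).
rewrite !final //; move: lV; rewrite defV !inE => /orP[] /eqP ->.
  by rewrite eqxx [v == u]eq_sym (negPf uv).
by rewrite eqxx (negPf uv).
Qed.

End Execution.

(** * Twin runs and the injective encoding of IDs *)

Section TwinRun.
Local Open Scope nat_scope.
Variables (N : nat) (M : Type) (A : algorithm N M).

(* The run of [v] when its partner always copies its actions. *)
Definition twin_slot (v : 'I_N) (h : seq (feedback M)) : seq (feedback M) :=
  match A v h with
  | Halt _ => h
  | Act Idle => rcons h Nothing
  | Act Listen => rcons h Silence
  | Act (Transmit _) => rcons h Collision
  end.

Definition twin_history (v : 'I_N) (n : nat) : seq (feedback M) :=
  iter n (twin_slot v) [::].

(** Idling and halting are merged: neither affects the channel or is affected by it. *)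
Definition twin_act (v : 'I_N) (n : nat) : option bool :=
  match A v (twin_history v n) with
  | Act Listen => Some false
  | Act (Transmit _) => Some true
  | _ => None
  end.

(** The default [false] is harmless: outputs are compared only for twin runs that are real, and
    these have halted by then. *)
Definition twin_output (v : 'I_N) (n : nat) : bool :=
  if A v (twin_history v n) is Halt b then b else false.

Definition support_size (t : nat) (f : {ffun 'I_t -> option bool}) : nat :=
  \sum_(s < t) isSome (f s).

(* A twin run may exceed the energy bound, as it need not be a real run: only
   its first [k] awake slots are recorded. *)
Definition prune (k : nat) (p : nat -> option bool) (n : nat) : option bool :=
  if \sum_(i < n) isSome (p i) < k then p n else None.

Definition pattern (k t : nat) (v : 'I_N) : {ffun 'I_t -> option bool} :=
  [ffun s : 'I_t => prune k (twin_act v) s].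

Lemma sum_prune (k : nat) (p : nat -> option bool) (n : nat) :
  \sum_(s < n) isSome (prune k p s) = minn k (\sum_(s < n) isSome (p s)).
Proof.
elim: n => [|n IHn]; first by rewrite !big_ord0 minn0.
rewrite !big_ord_recr /= {}IHn /prune; set e := \sum_(i < n) _.
case: ltnP => [ek|ke] /=.
  by apply/esym/minn_idPr; case: (p n) => [b|]; rewrite ?addn1 ?addn0 // ltnW.
by rewrite addn0; apply/esym/minn_idPl/(leq_trans ke)/leq_addr.
Qed.

Lemma support_size_pattern (k t : nat) (v : 'I_N) :
  support_size (pattern k t v) <= k.
Proof.
rewrite /support_size; under eq_bigr do rewrite ffunE.
by rewrite sum_prune geq_minl.
Qed.

(** Strong induction: if the histories are twin histories so far, equal patterns force equal
    listen/transmit actions in the next slot, so listeners hear silence and transmitters a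
    collision. *)
Lemma twin_historyE (V : {set 'I_N}) (k t : nat) :
  1 < #|V| ->
  (forall v n, v \in V -> energy A V n v <= k) ->
  {in V &, forall u v, pattern k t u = pattern k t v} ->
  forall n, n <= t -> {in V, forall v, history A V n v = twin_history v n}.
Proof.
move=> V_gt1 energyV patV; elim/ltn_ind => [[|n] IHn] nt v vV //=.
have hist m w : m <= n -> w \in V -> history A V m w = twin_history w m.
  by move=> mn wV; apply: IHn => //; apply: leq_trans nt; apply: ltnW.
have awakeE m w : m <= n -> w \in V ->
    awake A V m w = isSome (twin_act w m).
  move=> mn wV; rewrite /awake /twin_act hist //.
  by case: (A w _) => [[]|].
have act_copied w w' b : w \in V -> w' \in V ->
    twin_act w n = Some b -> twin_act w' n = Some b.
  (* Counting slot [n] itself, [w] is awake in at most [k] slots, so fewer than [k] come before it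
     and pruning keeps its action. As the patterns agree, [w'] has the same action. *)
  move=> wV w'V wb; have := energyV w n.+1 wV.
  rewrite /energy big_ord_recr /= awakeE // wb addn1 => lt_k.
  have /ffunP/(_ (Ordinal nt)) := patV _ _ wV w'V.
  rewrite !ffunE /prune /= wb.
  rewrite (eq_bigr (fun i : 'I_n => awake A V i w : nat)); last first.
    by move=> i _; rewrite awakeE // ltnW.
  by rewrite lt_k; case: ifP.
rewrite -/(history A V n) -/(twin_history v n) /slot /twin_slot hist //.
case E: (A v (twin_history v n)) => [[| |m]|b] //; congr rcons.
  apply: channel_silence => w wV; rewrite /transmission hist //.
  have := act_copied v w false vV wV; rewrite /twin_act E => /(_ erefl).
  by case: (A w _) => [[]|].
apply: channel_collision => // w wV; rewrite /transmission hist //.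
have := act_copied v w true vV wV; rewrite /twin_act E => /(_ erefl).
by case: (A w _) => [[]|].
Qed.

Lemma pattern_output_inj (k t : nat) :
  (forall V : {set 'I_N}, #|V| = 2 -> elects_leader A V) ->
  (forall (V : {set 'I_N}) v n, #|V| = 2 -> v \in V -> energy A V n v <= k) ->
  (forall V : {set 'I_N}, #|V| = 2 -> terminated A V t) ->
  injective (fun v => (pattern k t v, twin_output v t)).
Proof.
move=> elect energyA term u v [pat out]; apply/eqP/negPn/negP => uv.
pose V := [set u; v]; have V2 : #|V| = 2 by rewrite cards2 uv.
have := elects_leader_output_neq erefl uv (term V V2) (elect V V2).
have patV : {in V &, forall u' v', pattern k t u' = pattern k t v'}.
  by move=> u' v'; rewrite !inE => /orP[] /eqP -> /orP[] /eqP ->.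
have outE w : w \in V -> output A V t w = Some (twin_output w t).
  move=> wV; have /forallP/(_ w)/implyP/(_ wV) := term V V2.
  rewrite /output /twin_output (twin_historyE (k := k) _ _ patV) ?V2 //.
    by case: (A w _).
  by move=> *; apply: energyA.
by rewrite !outE ?set21 ?set22 // out eqxx.
Qed.

End TwinRun.

(** * Counting words of small support *)

Lemma card_support_size_le (R : realFieldType) (k t : nat) (x : R) :
  0 <= x <= 1 ->
  #|[set f : {ffun 'I_t -> option bool} | (support_size f <= k)%N]|%:R * x ^+ k
    <= (1 + x *+ 2) ^+ t.
Proof.
case/andP => x0 x1.
have -> : (1 + x *+ 2) ^+ t =
    \sum_(f : {ffun 'I_t -> option bool}) x ^+ support_size f.
  (* Each letter weighs 1 if it is [None] and [x] otherwise; expanding the product gives one term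
     per word. *)
  transitivity (\prod_(s < t) \sum_(o : option bool) x ^+ isSome o).
    rewrite prodr_const card_ord; congr (_ ^+ _).
    rewrite (bigD1 None) //= expr0; congr (_ + _).
    rewrite (eq_bigr (fun=> x)); last by case.
    rewrite sumr_const; congr (_ *+ _).
    by have := cardC1 (@None bool); rewrite card_option card_bool.
  rewrite bigA_distr_bigA; apply: eq_bigr => f _.
  by rewrite /support_size prodrXr.
rewrite -sum1_card natr_sum mulr_suml big_mkcond /=.
apply: ler_sum => f _; rewrite inE; case: ifP => [fk|_]; last exact: exprn_ge0.
by rewrite mul1r ler_wiXn2l.
Qed.

Lemma ID_space_bound (R : realType) (N k t : nat) : (0 < k <= t)%N ->
  (N <= 2 * #|[set f : {ffun 'I_t -> option bool} | (support_size f <= k)%N]|)%N ->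
  k%:R * N%:R `^ k%:R^-1 <= 2 * expR 2 * t%:R :> R.
Proof.
case/andP => k0 kt leN.
have k0R : 0 < k%:R :> R by rewrite ltr0n.
have t0R : 0 < t%:R :> R by rewrite ltr0n (leq_trans k0).
pose x : R := k%:R / t%:R.
have x0 : 0 < x by rewrite divr_gt0.
have x1 : x <= 1 by rewrite ler_pdivrMr // mul1r ler_nat.
(* Chosen so that [k * y] is the right-hand side; it remains to prove [N <= y ^ k] and take [k]-th
   roots. *)
pose y : R := 2 * expR 2 / x.
have y0 : 0 <= y by rewrite divr_ge0 ?mulr_ge0 ?expR_ge0 // ltW.
have Ny : N%:R <= y ^+ k.
  rewrite expr_div_n ler_pdivlMr ?exprn_gt0 //.
  apply: (@le_trans _ _ (2 * (1 + x *+ 2) ^+ t)).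
    apply: le_trans (_ : 2 * (_ * x ^+ k) <= _); last first.
      by rewrite ler_pM2l //; apply: (@card_support_size_le _ k); rewrite ltW ?x1.
    by rewrite mulrA ler_pM2r ?exprn_gt0 // -natrM ler_nat.
  rewrite exprMn ler_pM //.
  - by rewrite exprn_ge0 // addr_ge0 // mulrn_wge0 // ltW.
  (* As [k >= 1], the factor 2 from the output bit is absorbed into [2 ^ k]. *)
  - by rewrite ler_eXnr // ler1n.
  (* Since [t * x = k], comparing [t]-th powers leaves [1 + 2 x <= exp (2 x)]. *)
  - have -> : expR 2 ^+ k = expR (x *+ 2) ^+ t :> R.
      rewrite -!expRM_natr; congr expR.
      by rewrite mulr_natl mulrnAl divfK ?gt_eqF.
    rewrite lerXn2r ?nnegrE ?expR_ge0 ?expR_ge1Dx //.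
    by rewrite addr_ge0 // mulrn_wge0 // ltW.
have -> : 2 * expR 2 * t%:R = k%:R * y :> R.
  by rewrite /y /x invf_div mulrCA (mulrC k%:R) divfK ?gt_eqF.
rewrite ler_pM2l //.
have -> : y = (y ^+ k) `^ k%:R^-1.
  by rewrite -powR_mulrn // -powRrM mulfV ?gt_eqF // powRr1.
by rewrite ge0_ler_powR ?nnegrE ?invr_ge0 ?exprn_ge0.
Qed.

Theorem theorem4p2 (R : realType) :
  exists2 c : R, 0 < c &
    forall (N : nat) (M : Type) (A : algorithm N M) (k t : nat),
      (forall V : {set 'I_N}, #|V| = 2%N -> elects_leader A V) ->
      energy_complexity A (fun V : {set 'I_N} => #|V| = 2%N) k ->
      time_complexity A (fun V : {set 'I_N} => #|V| = 2%N) t ->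
      c * (k%:R * N%:R `^ (k%:R^-1)) <= t%:R.
Proof.
have c0 : 0 < 2 * expR 2 :> R by rewrite mulr_gt0 ?expR_gt0.
exists (2 * expR 2)^-1; first by rewrite invr_gt0.
move=> N M A k t elect [energyA least_k] [term _].
have [->|k0] := posnP k; first by rewrite mul0r mulr0.
(* By termination [t] bounds the energy, and [k] is the least such bound; this makes the weight
   [k / t] at most 1. *)
have kt : (k <= t)%N.
  by apply: least_k => V v n V2 vV; apply: energy_terminated => //; apply: term.
rewrite ler_pdivrMl //; apply: ID_space_bound; first by rewrite k0.
have energyA' (V : {set 'I_N}) v n :
    #|V| = 2%N -> v \in V -> (energy A V n v <= k)%N by exact: energyA.
have inj := pattern_output_inj elect energyA' term.
rewrite -[X in (X <= _)%N]card_ord -(card_imset _ inj).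
rewrite mulnC -card_bool -cardsT -cardsX.
apply/subset_leq_card/fintype.subsetP => _ /imsetP[v _ ->].
by rewrite !inE support_size_pattern.
Qed.
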